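(* Let $P$ be a finite poset, $\mathbb K$ a field and $\epsilon\in\{1,-1\}$. Set $d_0=q^{(\epsilon)}\mathrm{dist}(-\infty,\infty)$ and $d_{\max}=\max\{q^{(\epsilon)}(x_0,y_0,\ldots,x_t,y_t): y_0,x_1,\ldots,y_{t-1},x_t$ is a $q^{(\epsilon)}$-reduced sequence satisfying condition N', $x_0=-\infty$, $y_t=\infty\}$. Then for every integer $d$ with $d_0\le d\le d_{\max}$ there is a generator of $\omega$ (if $\epsilon=1$), resp. of $\omega^{(-1)}$ (if $\epsilon=-1$), of degree $d$.
   Context: $P^\pm=P\cup\{-\infty,\infty\}$, $-\infty<z<\infty$ for $z\in P$. Saturated chain: $x=z_0\lessdot\cdots\lessdot z_t=y$, length $t$; $q^{(\epsilon)}\mathrm{dist}(x,y)=\max\{\epsilon t:$ saturated chain of length $t$ from $x$ to $y$ in $P^\pm\}$. For $w_0<z_0>w_1<\cdots>w_s<z_s$ in $P^\pm$, $q^{(\epsilon)}(w_0,z_0,\ldots,w_s,z_s)=\sum_{\ell=0}^s q^{(\epsilon)}\mathrm{dist}(w_\ell,z_\ell)-\sum_{\ell=0}^{s-1}q^{(\epsilon)}\mathrm{dist}(w_{\ell+1},z_\ell)$. Condition N': $y_0>x_1<y_1>\cdots<y_{t-1}>x_t$ in $P$ and $y_i\not>x_j$ whenever $i\le j-2$ (empty sequence allowed). $q^{(\epsilon)}$-reduced: with $x_0=-\infty,y_t=\infty$, $q^{(\epsilon)}\mathrm{dist}(x_i,y_j)<q^{(\epsilon)}(x_i,y_i,\ldots,x_j,y_j)$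 whenever $0\le i<j\le t$ and $x_i<y_j$. $R=\mathbb K[\mathcal C(P)]$ is the Ehrhart ring of the chain polytope $\mathcal C(P)=\{f\in\mathbb R^P:f\ge0,\sum_{c\in C}f(c)\le1$ for all chains $C\}$ (generated by $T^f=\prod_{x\in P\cup\{-\infty\}}T_x^{f(x)}$ with $f(-\infty)>0$, $f|_P/f(-\infty)\in\mathcal C(P)$, $\deg T^f=f(-\infty)$), $\omega$ its canonical ideal (monomials with $f|_P/f(-\infty)$ in the relative interior) and $\omega^{(-1)}=R:_{Q(R)}\omega$ the anticanonical ideal. Generators are the elements of the unique minimal Laurent-monomial generating set of the $R$-module. *)

(* Defs.v *)
From HB Require Import structures.
From mathcomp Require Import all_boot all_order all_algebra.
Set Implicit Arguments. Unset Strict Implicit. Unset Printing Implicit Defensive.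
Import Order.TTheory GRing.Theory Num.Theory.
Local Open Scope ring_scope.

Section Defs.
Context {disp : Order.disp_t} (P : finPOrderType disp).

Definition ext := option (option P).
Definition MInf : ext := None.
Definition PInf : ext := Some None.
Definition Elt (x : P) : ext := Some (Some x).

Definition ext_le (a b : ext) : bool :=
  match a, b with
  | None, _ => true
  | _, Some None => true
  | Some (Some x), Some (Some y) => (x <= y)%O
  | _, _ => false
  end.
Definition ext_lt (a b : ext) : bool := (a != b) && ext_le a b.

Definition ext_covers (a b : ext) : bool :=
  ext_lt a b && [forall z : ext, ~~ (ext_lt a z && ext_lt z b)].

Definition satchain (a b : ext) (t : nat) : bool :=
  [exists s : t.-tuple ext, path ext_covers a s && (last a s == b)].

(* saturated chains have t+1 distinct elements, so t < #|ext| *)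
Definition longest (a b : ext) : nat :=
  \max_(t < #|{: ext}| | satchain a b t) t.
Definition shortest (a b : ext) : nat :=
  \big[minn/#|{: ext}|]_(t < #|{: ext}| | satchain a b t) t.

(* q^(eps) dist(a,b) = max { eps * t : saturated chain of length t from a to b }
   (meaningful for a <= b; eps ∈ {1,-1}) *)
Definition qdist (eps : int) (a b : ext) : int :=
  if 0 < eps then eps * (longest a b)%:Z else eps * (shortest a b)%:Z.

(* q^(eps)(w_0,z_0,...,w_s,z_s) with W = [w_0..w_s], Z = [z_0..z_s] *)
Definition qseq (eps : int) (W Z : seq ext) : int :=
  \sum_(l < size Z) qdist eps (nth MInf W l) (nth MInf Z l)
  - \sum_(l < (size Z).-1) qdist eps (nth MInf W l.+1) (nth MInf Z l).

(* Sequence y_0, x_1, y_1, ..., y_{t-1}, x_t encoded by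
   ys = [y_0; ...; y_{t-1}] and xs = [x_1; ...; x_t]. *)
Definition Xfull (xs : seq P) : seq ext := MInf :: map Elt xs.
Definition Yfull (ys : seq P) : seq ext := rcons (map Elt ys) PInf.

(* condition N':  y_0 > x_1 < y_1 > ... < y_{t-1} > x_t in P, and
   y_i is not > x_j whenever i <= j-2.  (xs`_k = x_{k+1}, ys`_i = y_i.) *)
Definition condN' (xs ys : seq P) : Prop :=
  let xe := map Elt xs in let ye := map Elt ys in
  size xs = size ys /\
  (forall i, (i < size ys)%N -> ext_lt (nth MInf xe i) (nth MInf ye i)) /\
  (forall i, (i.+1 < size ys)%N -> ext_lt (nth MInf xe i) (nth MInf ye i.+1)) /\
  (forall i k, (i.+1 <= k)%N -> (k < size ys)%N ->
      ~~ ext_lt (nth MInf xe k) (nth MInf ye i)).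

Definition qreduced (eps : int) (xs ys : seq P) : Prop :=
  let X := Xfull xs in let Y := Yfull ys in
  forall i j, (i < j)%N -> (j <= size ys)%N ->
    ext_lt (nth MInf X i) (nth MInf Y j) ->
    qdist eps (nth MInf X i) (nth MInf Y j)
      < qseq eps (drop i (take j.+1 X)) (drop i (take j.+1 Y)).

Definition qval (eps : int) (xs ys : seq P) : int := qseq eps (Xfull xs) (Yfull ys).

(* None stands for -oo; deg T^f = f(-oo). *)
Definition expo := {ffun option P -> int}.
Definition deg (f : expo) : int := f None.

Definition is_chain (C : {set P}) : bool :=
  [forall x in C, forall y in C, (x <= y)%O || (y <= x)%O].

Definition in_chain_polytope (h : P -> rat) : Prop :=
  (forall x, 0 <= h x) /\ (forall C : {set P}, is_chain C -> \sum_(c in C) h c <= 1).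

(* (relative = topological, since C(P) is full-dimensional) interior *)
Definition in_interior (h : P -> rat) : Prop :=
  exists e : rat, 0 < e /\
    forall g : P -> rat, (forall x, `|g x - h x| < e) -> in_chain_polytope g.

(* exponents of monomials of R = K[C(P)] (T^0 = 1 included) *)
Definition RE (f : expo) : Prop :=
  0 <= f None /\ (forall x, 0 <= f (Some x)) /\
  (forall C : {set P}, is_chain C -> \sum_(c in C) f (Some c) <= f None).

(* exponents of the monomials of the canonical ideal omega *)
Definition omegaE (f : expo) : Prop :=
  0 < f None /\ in_interior (fun x => (f (Some x))%:~R / (f None)%:~R).

(* exponents of the Laurent monomials of omega^(-1) = R :_{Q(R)} omega *)
Definition antiE (g : expo) : Prop := forall f, omegaE f -> RE (g + f).

(* G is a Laurent-monomial generating set of the R-module with monomials S *)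
Definition generates (S G : expo -> Prop) : Prop :=
  (forall g, G g -> S g) /\ (forall s, S s -> exists g, G g /\ RE (s - g)).

Definition minimal_gen (S G : expo -> Prop) : Prop :=
  generates S G /\
  forall G', generates S G' -> (forall g, G' g -> G g) -> forall g, G g -> G' g.

Definition is_generator (S : expo -> Prop) (m : expo) : Prop :=
  (exists G, minimal_gen S G) /\ (forall G, minimal_gen S G -> G m).
End Defs.

(* Main.v *)
Require Import Defs.
From HB Require Import structures.
From mathcomp Require Import all_boot all_order all_algebra.
From mathcomp Require Import zify ring lra.
From Stdlib Require Import Classical.
Set Implicit Arguments. Unset Strict Implicit. Unset Printing Implicit Defensive.
Import Order.TTheory GRing.Theory Num.Theory.
Local Open Scope ring_scope.

(** Write [D] for [q^(eps)dist].  Give the points of the sequence heights: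
    [al 0 = d], [be k = al k - D (x_k, y_k)] and
    [al (k+1) = be k + D (x_(k+1), y_k)], and cut the sequence at the first [t]
    with [al t <= D (x_t, oo)], where [al t] is raised to [D (x_t, oo)] and
    [y_t] is replaced by [oo] at height [0].  Reducedness, N' and the choice
    of [t] give [al k >= be l + D (x_k, y_l)] whenever [x_k < y_l].  The lower envelope
    [b z = min_(x_k < z) (al k - D (x_k, z))] then satisfies [b (y_k) = be k] and
    decreases by at least [eps] along covers, so
    [m z = b z - max_(w covers z) b w] lies in the module and has degree [d].

    For each [k] there is a maximal chain [C_k] through [x_k] and [y_k] whose facet
    inequality is an equality at [m], and [m = eps] on [C_k] strictly between them.
    If [m = g + r] with [g] in the module and [r] in [R], then [r] vanishes there and
    [r(C_k) >= deg r]; the part of [C_(k+1)] below [x_(k+1)] and the part of [C_k]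
    above [y_k] form a chain, on which [r] sums to at most [deg r].  Summing over
    [k = 0..t], the [t+1] lower bounds and [t] upper bounds force [deg r = 0]. *)

Lemma exists_max_int (T : finType) (p : pred T) (F : T -> int) (i0 : T) :
  p i0 -> exists2 i, p i & forall j, p j -> F j <= F i.
Proof. by move=> pi0; case: (@arg_maxP _ _ T i0 p F pi0) => i pi le_i; exists i. Qed.

Lemma geq_bigminn (I : eqType) (r : seq I) (p : pred I) (F : I -> nat) (n : nat) (i : I) :
  i \in r -> p i -> (\big[minn/n]_(j <- r | p j) F j <= F i)%N.
Proof.
elim: r => // k r IHr; rewrite in_cons big_cons => /predU1P[<- ->|ir pi]; first exact: geq_minl.
case: ifP => _; last exact: IHr.
exact: leq_trans (geq_minr _ _) (IHr ir pi).
Qed.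

(** * Paths of covers and the distance *)

Section Ext.
Context {disp : Order.disp_t} (P : finPOrderType disp).
Local Notation E := (ext P).
Implicit Types (a b c z : E) (s : seq E) (x y : P).

Lemma ext_lexx a : ext_le a a.
Proof. by case: a => [[x|]|] //=. Qed.

Lemma ext_le_trans b a c : ext_le a b -> ext_le b c -> ext_le a c.
Proof. by case: a b c => [[x|]|] [[y|]|] [[z|]|] //=; exact: le_trans. Qed.

Lemma ext_le_anti a b : ext_le a b -> ext_le b a -> a = b.
Proof.
by case: a b => [[x|]|] [[y|]|] //= xy yx; rewrite (@le_anti _ _ x y) ?xy ?yx.
Qed.

Lemma ext_ltW a b : ext_lt a b -> ext_le a b.
Proof. by case/andP. Qed.

Lemma ext_ltxx a : ext_lt a a = false.
Proof. by rewrite /ext_lt eqxx. Qed.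

Lemma ext_lt_le_trans b a c : ext_lt a b -> ext_le b c -> ext_lt a c.
Proof.
move=> /andP[ab leb] bc; apply/andP; split; last exact: ext_le_trans leb _.
by apply: contraNneq ab => ac; rewrite (ext_le_anti leb) // ac.
Qed.

Lemma ext_lt_trans : transitive (@ext_lt _ P).
Proof. by move=> b a c ab /ext_ltW; exact: ext_lt_le_trans. Qed.

Lemma ext_lt_MInf a : a != MInf P -> ext_lt (MInf P) a.
Proof. by move=> aN; rewrite /ext_lt eq_sym aN. Qed.

Lemma ext_lt_PInf a : a != PInf P -> ext_lt a (PInf P).
Proof. by move=> aN; rewrite /ext_lt aN; case: a aN => [[x|]|]. Qed.

Lemma ext_lt_neqMInf a b : ext_lt a b -> b != MInf P.
Proof. by apply: contraTneq => ->; case: a => [[x|]|]. Qed.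

Lemma ext_lt_neqPInf a b : ext_lt a b -> a != PInf P.
Proof. by apply: contraTneq => ->; case: b => [[x|]|]. Qed.

Lemma ext_covers_lt a b : ext_covers a b -> ext_lt a b.
Proof. by case/andP. Qed.

Lemma path_covers_lt a s : path (@ext_covers _ P) a s -> path (@ext_lt _ P) a s.
Proof. by apply: sub_path => u v; exact: ext_covers_lt. Qed.

Lemma path_covers_gt a s z : path (@ext_covers _ P) a s -> z \in s -> ext_lt a z.
Proof.
by move/path_covers_lt => /(order_path_min ext_lt_trans)/allP; apply.
Qed.

Lemma path_covers_le a s z :
  path (@ext_covers _ P) a s -> z \in a :: s -> ext_le a z.
Proof.
move=> ps; rewrite inE => /predU1P[->|zs]; first exact: ext_lexx.
exact/ext_ltW/(path_covers_gt ps).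
Qed.

Lemma path_covers_le_last a s z :
  path (@ext_covers _ P) a s -> z \in a :: s -> ext_le z (last a s).
Proof.
elim: s a => [|u s IHs] a /=; first by move=> _; rewrite inE => /eqP ->; exact: ext_lexx.
case/andP=> au ps; rewrite in_cons => /predU1P[->|zs]; last exact: IHs zs.
apply: ext_le_trans (ext_ltW (ext_covers_lt au)) _.
exact: (path_covers_le ps (mem_last _ _)).
Qed.

Lemma path_covers_uniq a s : path (@ext_covers _ P) a s -> uniq (a :: s).
Proof.
move/path_covers_lt => ps.
exact: (sorted_uniq ext_lt_trans ext_ltxx (ps : sorted _ (a :: s))).
Qed.

Lemma path_covers_size a s : path (@ext_covers _ P) a s -> (size s < #|{: E}|)%N.
Proof.
move/path_covers_uniq/card_uniqP => /= <-.
exact: max_card.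
Qed.

Lemma ext_lt_ind_up (Q : E -> Prop) :
  (forall a, (forall b, ext_lt a b -> Q b) -> Q a) -> forall a, Q a.
Proof.
move=> step a; have [n le_n] := ubnP #|[pred b | ext_lt a b]|.
elim: n a le_n => // n IHn a le_n; apply: step => b ab; apply: IHn.
rewrite ltnS in le_n; apply: leq_trans le_n; apply: proper_card; apply/properP; split.
  by apply/subsetP => c; rewrite !inE; exact: ext_lt_trans ab.
by exists b; rewrite !inE // ext_ltxx.
Qed.

Lemma ext_lt_ind_down (Q : E -> Prop) :
  (forall a, (forall b, ext_lt b a -> Q b) -> Q a) -> forall a, Q a.
Proof.
move=> step a; have [n le_n] := ubnP #|[pred b | ext_lt b a]|.
elim: n a le_n => // n IHn a le_n; apply: step => b ba; apply: IHn.
rewrite ltnS in le_n; apply: leq_trans le_n; apply: proper_card; apply/properP; split.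
  by apply/subsetP => c; rewrite !inE => cb; exact: ext_lt_trans ba.
by exists b; rewrite !inE // ext_ltxx.
Qed.

Lemma exists_cover a b : ext_lt a b -> exists2 c, ext_covers a c & ext_le c b.
Proof.
elim/ext_lt_ind_down: b => b IHb ab.
have [/existsP[z /andP[az zb]]|] := boolP [exists z, ext_lt a z && ext_lt z b].
  have [c ac cz] := IHb z zb az; exists c => //.
  exact: ext_le_trans cz (ext_ltW zb).
by rewrite negb_exists => nz; exists b; rewrite /ext_covers ?ab ?ext_lexx.
Qed.

Lemma exists_path_covers a b : ext_le a b ->
  exists2 s, path (@ext_covers _ P) a s & last a s = b.
Proof.
elim/ext_lt_ind_up: a => a IHa ab; have [->|aNb] := eqVneq a b; first by exists [::].
have [c ac cb] := exists_cover (introT andP (conj aNb ab)).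
have [s ps ls] := IHa c (ext_covers_lt ac) cb.
by exists (c :: s) => //=; rewrite ac.
Qed.

Lemma path_lt_refine a s : path (@ext_lt _ P) a s ->
  exists s', [/\ path (@ext_covers _ P) a s', last a s' = last a s & {subset s <= s'}].
Proof.
elim: s a => [|u s IHs] a /=; first by exists [::].
case/andP=> au /IHs[s2 [p2 l2 sub2]].
have [s1 p1 l1] := exists_path_covers (ext_ltW au).
exists (s1 ++ s2); split; first by rewrite cat_path p1 l1.
  by rewrite last_cat l1.
move=> z; rewrite mem_cat inE => /predU1P[->|/sub2 ->]; last by rewrite orbT.
have : u \in a :: s1 by rewrite -l1 mem_last.
by rewrite inE => /predU1P[ua|->] //; rewrite ua ext_ltxx in au.
Qed.

(** Otherwise [z] would fall strictly between two consecutive members of the path, against the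
    covering relation. This is the maximality of saturated chains from -oo to oo. *)
Lemma path_covers_mem a s z : path (@ext_covers _ P) a s ->
  ext_le a z -> ext_le z (last a s) ->
  (forall u, u \in s -> ext_le u z || ext_le z u) -> z \in a :: s.
Proof.
elim: s a => [|u s IHs] a /=; first by move=> _ az za _; rewrite (ext_le_anti az za) mem_head.
case/andP=> /andP[au /forallP nz] ps az zl cmp.
have /orP[uz|zu] := cmp u (mem_head _ _).
  by rewrite inE IHs ?orbT // => v vs; rewrite cmp // inE vs orbT.
have := nz z; rewrite negb_and /ext_lt az zu !andbT !negbK => /orP[]/eqP <-.
  exact: mem_head.
by rewrite !inE eqxx orbT.
Qed.

End Ext.

Section Qdist.
Context {disp : Order.disp_t} (P : finPOrderType disp).
Context (eps : int) (heps : eps = 1 \/ eps = -1).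
Local Notation E := (ext P).
Local Notation D := (@qdist _ P eps).
Implicit Types (a b c z : E) (s : seq E) (x y : P).

Lemma satchain_size a s :
  path (@ext_covers _ P) a s -> satchain a (last a s) (size s).
Proof. by move=> ps; apply/existsP; exists (in_tuple s); rewrite /= ps eqxx. Qed.

Lemma qdist_ge a s : path (@ext_covers _ P) a s ->
  eps * (size s)%:Z <= D a (last a s).
Proof.
move=> ps; have sc := satchain_size ps; have lt := path_covers_size ps.
rewrite /qdist; case: heps => -> /=.
  rewrite !mul1r lez_nat /longest.
  exact: (@leq_bigmax_cond _ (fun t : 'I__ => satchain a (last a s) t) _ (Ordinal lt)).
rewrite !mulN1r lerN2 lez_nat /shortest.
apply: (@geq_bigminn _ _ (fun t : 'I__ => satchain a (last a s) t) _ _ (Ordinal lt)) => //.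
exact: mem_index_enum.
Qed.

Lemma qdist_path a b : ext_le a b ->
  exists s, [/\ path (@ext_covers _ P) a s, last a s = b & D a b = eps * (size s)%:Z].
Proof.
move=> ab; have [s0 p0 l0] := exists_path_covers ab.
have sc0 := satchain_size p0; rewrite l0 in sc0; have lt0 := path_covers_size p0.
suff [t tc Dt] : exists2 t : nat, satchain a b t & D a b = eps * t%:Z.
  by move: tc => /existsP[s /andP[ps /eqP ls]]; exists s; rewrite size_tuple.
rewrite /qdist; case: heps => -> /=.
  rewrite /longest; case: (@eq_bigmax_cond _ (fun t : 'I_#|{: E}| => satchain a b t) (@nat_of_ord _)).
    by apply/card_gt0P; exists (Ordinal lt0).
  by move=> i si ->; exists i.
(* The iterated minimum is either attained by a saturated chain or equal to its default [#|E|]; the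
   existing path [s0] is shorter than that default. *)
suff [sc|eqc] : (satchain a b (shortest a b)) \/ shortest a b = #|{: E}|.
  by exists (shortest a b).
  have : (shortest a b <= size s0)%N.
    apply: (@geq_bigminn _ _ (fun t : 'I__ => satchain a b t) _ _ (Ordinal lt0)) => //.
    exact: mem_index_enum.
  by rewrite eqc leqNgt lt0.
rewrite /shortest; elim/big_ind: _ => [|m n Hm Hn|i si]; [by right| |by left].
by rewrite /minn; case: ifP.
Qed.

(** For both signs the distance is a maximum, and concatenating optimal chains gives a competitor: a
    reverse triangle inequality. *)
Lemma qdist_super a b c : ext_le a b -> ext_le b c -> D a b + D b c <= D a c.
Proof.
move=> ab bc; have [s [ps ls ->]] := qdist_path ab; have [s' [ps' ls' ->]] := qdist_path bc.
have -> : c = last a (s ++ s') by rewrite last_cat ls.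
rewrite -mulrDr -PoszD -size_cat; apply: qdist_ge.
by rewrite cat_path ps ls.
Qed.

Lemma qdist_covers a b : ext_covers a b -> eps <= D a b.
Proof. by move=> ab; have := @qdist_ge a [:: b]; rewrite /= ab mulr1; apply. Qed.

End Qdist.

(** * Facet description of the canonical and anticanonical modules *)

Section Facets.
Context {disp : Order.disp_t} (P : finPOrderType disp).
Local Notation E := (ext P).
Implicit Types (a b c z : E) (s : seq E) (x y : P) (f g r m : expo P) (C : {set P}).

Definition maximal_path s :=
  path (@ext_covers _ P) (MInf P) s && (last (MInf P) s == PInf P).

Definition elts s : {set P} := [set x | Elt x \in s].

(** Vanishes at both infinities, so that sums over [elts s] can be computed by recursion along the
    path [s]. *)
Definition weight f z : int := if z is Some (Some x) then f (Some x) else 0.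

(* The set S^(eps) of lattice points at distance at least [eps] from every facet
   of the cone over the chain polytope. *)
Definition facets (eps : int) f :=
  (forall x, eps <= f (Some x)) /\
  (forall s, maximal_path s -> \sum_(x in elts s) f (Some x) + eps <= f None).

Lemma expoD f g o : (f + g) o = f o + g o.
Proof. by rewrite ffunE. Qed.

Lemma expoB f g o : (f - g) o = f o - g o.
Proof. by rewrite !ffunE. Qed.

Lemma card_set_le C : (#|C| <= #|P|)%N.
Proof. exact: max_card. Qed.

Lemma exists_maximal_path : exists s, maximal_path s.
Proof.
have [//|s ps ls] := @exists_path_covers _ P (MInf P) (PInf P).
by exists s; rewrite /maximal_path ps ls eqxx.
Qed.

Lemma sum_elts f a s : path (@ext_covers _ P) a s ->
  \sum_(x in elts s) f (Some x) = \sum_(z <- s) weight f z.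
Proof.
move/path_covers_uniq => /= /andP[_ us].
rewrite big_uniq //= (bigID (fun z : E => if z is Some (Some x) then true else false)) /=.
rewrite [X in _ + X]big1 ?addr0; last by case=> [[x|]|] //=; rewrite andbF.
rewrite (reindex_omap (@Elt _ P) (fun z : E => if z is Some w then w else None)) /=.
  by apply: eq_bigl => x; rewrite inE /= eqxx !andbT.
by case=> [[x|]|] //=; rewrite andbF.
Qed.

Lemma is_chainP C : reflect {in C &, forall x y, (x <= y)%O || (y <= x)%O} (is_chain C).
Proof.
apply: (iffP idP) => [/forall_inP h x y xC yC|h].
  exact: (forall_inP (h x xC)).
by apply/forall_inP => x xC; apply/forall_inP => y yC; exact: h.
Qed.

Lemma path_covers_cmp a s z z' : path (@ext_covers _ P) a s ->
  z \in a :: s -> z' \in a :: s -> ext_le z z' || ext_le z' z.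
Proof.
elim: s a => [|u s IHs] a ps.
  by rewrite !inE => /eqP -> /eqP ->; rewrite ext_lexx.
rewrite !(in_cons a) => /predU1P[->|zs] /predU1P[->|zs'].
- by rewrite ext_lexx.
- by rewrite (path_covers_le ps) // in_cons zs' orbT.
- by rewrite (path_covers_le ps) ?orbT // in_cons zs orbT.
- by case/andP: ps => _ /IHs; apply.
Qed.

Lemma is_chain_elts a s : path (@ext_covers _ P) a s -> is_chain (elts s).
Proof.
move=> ps; apply/is_chainP => x y; rewrite !inE => xs ys.
by apply: (@path_covers_cmp a s (Elt x) (Elt y)); rewrite // in_cons ?xs ?ys orbT.
Qed.

Lemma elts_maximal s x : maximal_path s ->
  {in elts s, forall y, (x <= y)%O || (y <= x)%O} -> x \in elts s.
Proof.
case/andP=> ps /eqP ls cmp; rewrite inE.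
suff : Elt x \in MInf P :: s by [].
apply: (path_covers_mem ps) => //; first by rewrite ls.
by case=> [[y|]|] // ys; rewrite /= orbC cmp ?inE.
Qed.

(** Sort the chain, append oo and fill the gaps with saturated chains. Inequalities for all chains
    thereby reduce to maximal ones. *)
Lemma is_chain_extend C : is_chain C ->
  exists2 s, maximal_path s & C \subset elts s.
Proof.
move/is_chainP => chC; pose l := sort <=%O (enum C).
have sl : sorted <%O l.
  rewrite lt_sorted_uniq_le sort_uniq enum_uniq /=.
  apply: (@sort_sorted_in _ (mem C)); first by move=> x y xC yC; exact: chC.
  by apply/allP => x; rewrite mem_enum.
have pl : path (@ext_lt _ P) (MInf P) (rcons (map (@Elt _ P) l) (PInf P)).
  rewrite rcons_path; apply/andP; split; last first.
    by case/lastP: l {sl} => // l x; rewrite map_rcons last_rcons.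
  case: l sl => //= x l sl; rewrite path_map.
  by apply: sub_path sl => u v; rewrite /= lt_neqAle /ext_lt /=.
have [s [ps ls sub]] := path_lt_refine pl.
exists s; first by rewrite /maximal_path ps ls last_rcons eqxx.
apply/subsetP => x xC; rewrite inE sub // mem_rcons in_cons; apply/orP; right.
by apply: map_f; rewrite mem_sort mem_enum.
Qed.

Lemma facets_chain (eps : int) f C : facets eps f ->
  (forall x, 0 <= f (Some x)) -> is_chain C ->
  \sum_(c in C) f (Some c) + eps <= f None.
Proof.
move=> [_ ff] f0 /is_chain_extend[s ms /setIidPr sub].
apply: le_trans (ff s ms); rewrite lerD2r [leRHS](big_setID C) /= sub.
by rewrite lerDl sumr_ge0.
Qed.

(** Interior points are those satisfying every facet inequality strictly; for integers, strict means
    a slack of at least 1. *)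
Lemma omegaE_facets f : omegaE f <-> facets 1 f.
Proof.
split=> [[n0 [e [e0 he]]]|ff].
- have n0' : 0 < (f None)%:~R :> rat by rewrite ltr0z.
  split=> [x|s ms].
    have [] := he (fun x => (f (Some x))%:~R / (f None)%:~R - e / 2%:R).
      by move=> y; rewrite addrAC subrr add0r normrN gtr0_norm; lra.
    move=> /(_ x) + _; rewrite -gtz0_ge1 -(ltr0z rat) => h.
    have : 0 < (f (Some x))%:~R / (f None)%:~R :> rat by lra.
    by rewrite pmulr_lgt0 // invr_gt0.
  have ch := is_chain_elts (proj1 (andP ms)).
  have [] := he (fun x => (f (Some x))%:~R / (f None)%:~R + e / 2%:R).
    by move=> y; rewrite addrAC subrr add0r gtr0_norm; lra.
  move=> _ /(_ _ ch); rewrite big_split /= sumr_const -mulr_suml -rmorph_sum /=.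
  (* On an empty chain the perturbation changes nothing, and the claim is just [0 < f None]. *)
  rewrite lezD1; have [c0|cp] := posnP #|elts s|.
    by rewrite big1 // => x xs; move: (card0_eq c0 x); rewrite xs.
  move=> h; rewrite -(ltr_int rat).
  have : (\sum_(x in elts s) f (Some x))%:~R / (f None)%:~R < 1 :> rat.
    apply: lt_le_trans h; rewrite ltrDl pmulrn_lgt0 //; lra.
  by rewrite ltr_pdivrMr // mul1r.
- have f0 x : 0 <= f (Some x) by apply: le_trans (ff.1 x).
  have n0 : 0 < f None.
    have [s ms] := exists_maximal_path; apply: lt_le_trans (ff.2 s ms).
    by rewrite ltr_wpDl ?sumr_ge0.
  have n0' : 0 < (f None)%:~R :> rat by rewrite ltr0z.
  split=> //; pose k : rat := #|P|.+1%:R; have k0 : 0 < k by rewrite ltr0n.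
  (* After division by [f None] each slack is at least [1 / f None], and a chain has at most
     [#|P| < k] coordinates that can move. *)
  exists ((f None)%:~R^-1 / k); split; first by rewrite divr_gt0 ?invr_gt0.
  move=> g hg.
  have le1 : (f None)%:~R^-1 / k <= (f None)%:~R^-1.
    by rewrite ler_piMr ?invr_ge0 ?(ltW n0') // invf_le1 // ler1n.
  split=> [x|C chC].
    have /= := hg x; rewrite ltr_norml => /andP[h1 h2].
    have : (f None)%:~R^-1 <= (f (Some x))%:~R / (f None)%:~R :> rat.
      by rewrite ler_peMl ?invr_ge0 ?(ltW n0') // ler1z ff.1.
    move: h1 le1; set u := _ / k; set v := _^-1; set w := _ / _; lra.
  have hC := facets_chain ff f0 chC.
  apply: (@le_trans _ _ (\sum_(c in C) ((f (Some c))%:~R / (f None)%:~R + (f None)%:~R^-1 / k))).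
    apply: ler_sum => c _; have /= := hg c; rewrite ltr_norml => /andP[_].
    by rewrite ltrBlDl => /ltW; rewrite addrC.
  rewrite big_split /= sumr_const -mulr_suml -rmorph_sum /=.
  have : (\sum_(i in C) f (Some i))%:~R + 1 <= (f None)%:~R :> rat.
    by rewrite -(intrD _ _ 1) ler_int.
  set S := _%:~R => hS.
  have : (f None)%:~R^-1 / k *+ #|C| <= (f None)%:~R^-1 :> rat.
    rewrite -mulr_natr -mulrA ler_piMr ?invr_ge0 ?(ltW n0') //.
    rewrite mulrC ler_pdivrMr // mul1r ler_nat ltnW // ltnS.
    exact: card_set_le.
  move=> h; apply: (@le_trans _ _ (S / (f None)%:~R + (f None)%:~R^-1)); first by rewrite lerD2l.
  by rewrite -[X in _ + X]mul1r -mulrDl ler_pdivrMr // mul1r.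
Qed.

(** The slacks -1 of [g] and 1 of [f] add up to a nonnegative slack. Conversely, each facet
    inequality for [g] is read off from an element of omega lying at distance exactly 1 from that
    facet. *)
Lemma antiE_facets g : antiE g <-> facets (-1) g.
Proof.
split=> [ag|fg f /omegaE_facets ff]; last first.
  have p0 x : 0 <= (g + f) (Some x).
    by rewrite expoD; have := fg.1 x; have := ff.1 x; lia.
  have f0 x : 0 <= f (Some x) by have := ff.1 x; lia.
  have hC C : is_chain C -> \sum_(c in C) (g + f) (Some c) <= (g + f) None.
    move=> /is_chain_extend[s ms /setIidPr sub].
    have chs := is_chain_elts (proj1 (andP ms)).
    apply: (@le_trans _ _ (\sum_(c in elts s) (g + f) (Some c))).
      by rewrite [leRHS](big_setID C) /= sub lerDl sumr_ge0.
    under eq_bigr do rewrite expoD.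
    rewrite big_split expoD /=.
    by have := lerD (fg.2 s ms) (ff.2 s ms); rewrite addrACA addNr addr0.
  split; last by split.
  have := hC set0; rewrite big_set0; apply.
  by apply/is_chainP => x; rewrite inE.
split=> [x|s ms].
  (* All coordinates are 1, the least value allowed in omega; the degree [#|P| + 1] leaves room for
     every chain. *)
  pose f : expo P := [ffun o => if o is Some _ then 1 else #|P|.+1%:Z].
  have ff : facets 1 f.
    split=> [y|s ms]; rewrite ffunE //.
    under eq_bigr do rewrite ffunE.
    rewrite sumr_const; have := card_set_le (elts s).
    by rewrite /= -[1 *+ _]/(_%:R) natz; lia.
  have /ag[_ [h _]] : omegaE f by apply/omegaE_facets.
  by have := h x; rewrite expoD [f _]ffunE /=; lia.
pose N : int := #|P|.+1%:Z.
(* Weight concentrated on [elts s]: by maximality every other chain misses a point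
   of [elts s], so [s] is the only facet that is tight at [f]. *)
pose f : expo P := [ffun o => if o is Some x then (if x \in elts s then N else 1)
                              else N * #|elts s|%:Z + 1].
have sums C : \sum_(x in C) f (Some x) = N * #|C :&: elts s|%:Z + #|C :\: elts s|%:Z.
  rewrite (big_setID (elts s)) /=; congr (_ + _).
    under eq_bigr => x xC do rewrite ffunE (setIP xC).2.
    by rewrite sumr_const -mulr_natr natz.
  under eq_bigr => x do rewrite inE ffunE => /andP[/negbTE -> _].
  by rewrite sumr_const -[1 *+ _]/(_%:R) natz.
have ff : facets 1 f.
  split=> [x|s' ms'].
    by rewrite ffunE; case: ifP => _ //; rewrite /N; lia.
  rewrite sums [f None]ffunE lerD2r.
  have [sub|] := boolP (elts s \subset elts s').
    suff -> : elts s' = elts s by rewrite setIid setDv cards0 addr0.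
    apply/eqP; rewrite eqEsubset sub andbT; apply/subsetP => x xs'.
    apply: (elts_maximal ms) => y /(subsetP sub) ys'.
    exact: (is_chainP _ (is_chain_elts (proj1 (andP ms')))).
  move=> nsub.
  have lt : (#|elts s' :&: elts s| < #|elts s|)%N.
    apply: proper_card; rewrite properEneq subsetIr andbT.
    by apply: contra nsub => /eqP <-; exact: subsetIl.
  (* A missed point of [elts s] costs [N], more than the at most [#|P|] gained from points outside
     [elts s]. *)
  have := card_set_le (elts s' :\: elts s); rewrite /N.
  by move: lt; set a := #|_ :&: _|; set b := #|elts s|; set c := #|_ :\: _|; nia.
have /ag[_ [_ h]] : omegaE f by apply/omegaE_facets.
have := h _ (is_chain_elts (proj1 (andP ms))).
under eq_bigr do rewrite expoD.
rewrite big_split expoD /= sums setIid setDv cards0 addr0 [f None]ffunE.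
by rewrite [N * _ + 1]addrC addrA lerD2r lerBlDr.
Qed.

(** * Irreducible elements as generators *)

Lemma RE0 : RE (0 : expo P).
Proof.
split; first by rewrite ffunE.
split=> [x|C _]; rewrite ffunE //.
by rewrite big1 // => c _; rewrite ffunE.
Qed.

Lemma RE_add f g : RE f -> RE g -> RE (f + g).
Proof.
move=> [f0 [fx fC]] [g0 [gx gC]]; split; first by rewrite expoD addr_ge0.
split=> [x|C ch]; rewrite expoD ?addr_ge0 //.
under eq_bigr do rewrite expoD.
by rewrite big_split lerD //= ?fC ?gC.
Qed.

Lemma RE_eq0 r : RE r -> r None <= 0 -> r = 0.
Proof.
move=> [r0 [rx rC]] r0'; apply/ffunP => -[x|]; rewrite ffunE; last by apply/eqP; rewrite eq_le r0 r0'.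
apply/eqP; rewrite eq_le rx andbT; apply: le_trans r0'.
have := rC [set x]; rewrite big_set1; apply.
by apply/is_chainP => y z; rewrite !inE => /eqP -> /eqP ->; rewrite lexx.
Qed.

(** The irreducible elements form a minimal generating set, and every generating set contains them.
    The bound [L] makes the descent on degrees terminate. *)
Lemma irreducible_is_generator (S : expo P -> Prop) (L : int) m :
  (forall g, S g -> L <= g None) -> S m ->
  (forall g, S g -> RE (m - g) -> g = m) -> is_generator S m.
Proof.
move=> SL Sm irrm; pose irr f := S f /\ forall g, S g -> RE (f - g) -> g = f.
have irrE f g : S g -> RE (f - g) -> f None - g None <= 0 -> g = f.
  move=> Sg rfg le0; apply/esym/eqP; rewrite -subr_eq0; apply/eqP.
  by apply: RE_eq0; rewrite // expoB.
split.
  exists irr; split.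
    split=> [g []//|f].
    have [n] := ubnP `|f None - L|%N; elim: n f => // n IHn f lt Sf.
    have [fi|nfi] := classic (irr f).
      by exists f; split=> //; rewrite subrr; exact: RE0.
    (* A reducible element is divisible by another element of [S], whose degree is strictly smaller
       by [irrE]. *)
    have [g [Sg rfg gf]] : exists g, [/\ S g, RE (f - g) & g <> f].
      apply: NNPP => ng; apply: nfi; split=> // g Sg rfg.
      by apply: NNPP => gf; apply: ng; exists g.
    have [||h [hi rgh]] := IHn g; [|by []|].
      have : f None - g None > 0.
        by rewrite ltNge; apply/negP => le0; apply: gf; exact: irrE.
      by have := SL g Sg; have := SL f Sf; lia.
    by exists h; split=> //; rewrite -(subrKA g) ; exact: RE_add.
  move=> G' [G'S gen] _ g [Sg gi]; have [g' [Gg' rg]] := gen g Sg.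
  by rewrite -(gi g' (G'S _ Gg') rg).
move=> G [[GS gen] _]; have [g [Gg rg]] := gen m Sm.
by rewrite -(irrm g (GS _ Gg) rg).
Qed.

(** Supplies the degree bound for the descent; for [eps = -1] degrees may be negative. *)
Lemma facets_None_ge (eps : int) f : eps = 1 \/ eps = -1 -> facets eps f ->
  - #|P|.+1%:Z <= f None.
Proof.
move=> heps [fx fs]; have [s ms] := exists_maximal_path; apply: le_trans (fs s ms).
have : \sum_(x in elts s) (-1 : int) <= \sum_(x in elts s) f (Some x).
  by apply: ler_sum => x _; apply: le_trans (fx x); case: heps => ->.
rewrite sumr_const -mulr_natr mulN1r natz; have := card_set_le (elts s).
by case: heps => ->; lia.
Qed.

End Facets.

(** * The generator attached to a sequence *)

Section Zigzag.
Context {disp : Order.disp_t} (P : finPOrderType disp).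
Local Notation E := (ext P).
Implicit Types (u w z : E) (s : seq E) (g r m : expo P).

Lemma zigzag_RE (t : nat) (X Y : nat -> E) (C : nat -> {set P}) r :
  X 0%N = MInf P -> Y t = PInf P ->
  (forall k, (k < t)%N -> ext_lt (X k.+1) (Y k)) ->
  (forall k, (k <= t)%N -> is_chain (C k)) ->
  (forall k c, (k <= t)%N -> c \in C k ->
     [|| ext_le (Elt c) (X k), ext_le (Y k) (Elt c) | r (Some c) == 0]) ->
  (forall k, (k <= t)%N -> r None <= \sum_(c in C k) r (Some c)) ->
  RE r -> r = 0.
Proof.
move=> X0 Yt YX chC splitC sumC Rr; have [_ [rx rC]] := Rr.
pose low k := [set c in C k | ext_le (Elt c) (X k)].
pose upp k := [set c in C k | ext_le (Y k) (Elt c)].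
pose S (A : {set P}) := \sum_(c in A) r (Some c).
have sumLU k : (k <= t)%N -> r None <= S (low k) + S (upp k).
  move=> kt; apply: le_trans (sumC k kt) _; rewrite (big_setID (low k)) /=.
  have -> : C k :&: low k = low k by apply/setIidPr/subsetP => c; rewrite inE => /andP[].
  rewrite lerD2l (big_setID (upp k)) /= [X in _ + X]big1 ?addr0 => [|c].
    by rewrite [leRHS](big_setID (C k :\: low k)) /= setIC lerDl sumr_ge0.
  rewrite !inE => /andP[nu /andP[nl cC]]; have := splitC k c kt cC.
  by move: nu nl; rewrite cC /= => /negbTE -> /negbTE -> /eqP.
(* Since [X k.+1 < Y k], the part of [C k.+1] below [X k.+1] and the part of [C k] above [Y k] are
   disjoint and together form a chain. *)
have stepLU k : (k < t)%N -> S (low k.+1) + S (upp k) <= r None.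
  move=> kt; have Xlt := YX k kt.
  have dis : [disjoint low k.+1 & upp k].
    apply/pred0P => c /=; rewrite !inE; apply/negP => /andP[/andP[_ cX] /andP[_ Yc]].
    by have := ext_lt_le_trans Xlt (ext_le_trans Yc cX); rewrite ext_ltxx.
  have -> : S (low k.+1) + S (upp k) = S (low k.+1 :|: upp k).
    by rewrite /S -bigU //; apply: eq_bigl => c; rewrite !inE.
  apply: rC; apply/is_chainP => x y; rewrite !inE.
  have cross a b : ext_le (Elt a) (X k.+1) -> ext_le (Y k) (Elt b) -> (a <= b)%O.
    by move=> aX /(ext_le_trans (ext_ltW Xlt)) /(ext_le_trans aX).
  move=> /orP[/andP[xC xX]|/andP[xC Yx]] /orP[/andP[yC yX]|/andP[yC Yy]].
  - exact: (is_chainP _ (chC _ kt)).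
  - by rewrite cross.
  - by rewrite orbC cross.
  - exact: (is_chainP _ (chC _ (ltnW kt))).
(* The two estimates give [S (low k.+1) <= S (low k)], and [low 0] is empty because [X 0] is -oo. *)
have low0 k : (k <= t)%N -> S (low k) <= 0.
  elim: k => [_|k IHk kt].
    by rewrite /S big1 // => c; rewrite inE X0 andbF.
  by have := IHk (ltnW kt); have := stepLU k kt; have := sumLU k (ltnW kt); lia.
apply: RE_eq0 => //; have := sumLU t (leqnn t); have := low0 t (leqnn t).
suff -> : S (upp t) = 0 by lia.
by rewrite /S big1 // => c; rewrite inE Yt andbF.
Qed.

(** * The lower envelope of the heights and its transfer *)

Section Envelope.
Context (eps : int) (heps : eps = 1 \/ eps = -1).
Local Notation D := (@qdist _ P eps).
Context (t : nat) (X Y : nat -> E) (al be : nat -> int).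
Context (X0 : X 0%N = MInf P) (Yt : Y t = PInf P) (bet : be t = 0).
Context (XY : forall k, (k <= t)%N -> ext_lt (X k) (Y k)).
Context (alE : forall k, (k <= t)%N -> al k = be k + D (X k) (Y k)).
Context (YX : forall k, (k < t)%N -> ext_lt (X k.+1) (Y k)).
Context (al_ge : forall k l, (k <= t)%N -> (l <= t)%N -> ext_lt (X k) (Y l) ->
  be l + D (X k) (Y l) <= al k).

Lemma exists_envelope : exists b : E -> int, forall z,
  (forall k, (k <= t)%N -> ext_lt (X k) z -> b z + D (X k) z <= al k) /\
  (z != MInf P -> exists k, [/\ (k <= t)%N, ext_lt (X k) z & b z + D (X k) z = al k]).
Proof.
suff /fin_all_exists : forall z, exists v : int,
  (forall k, (k <= t)%N -> ext_lt (X k) z -> v + D (X k) z <= al k) /\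
  (z != MInf P -> exists k, [/\ (k <= t)%N, ext_lt (X k) z & v + D (X k) z = al k]) by [].
move=> z; have [->|zN] := eqVneq z (MInf P).
  (* No [X k] lies below -oo, so the value there is arbitrary. *)
  by exists 0; split=> // k _ /ext_lt_neqMInf /eqP.
have h0 : ext_lt (X (ord0 : 'I_t.+1)) z by rewrite X0 ext_lt_MInf.
have [k kz kmax] := exists_max_int (p := fun k : 'I_t.+1 => ext_lt (X k) z)
  (fun k => D (X k) z - al k) h0.
exists (al k - D (X k) z); split=> [l lt lz|_].
  by have := kmax (Ordinal (lt : (l < t.+1)%N)) lz => /=; lia.
by exists k; rewrite -ltnS ltn_ord kz subrK.
Qed.

Lemma exists_cover_max (b : E -> int) : exists top : E -> int, forall z,
  (forall w, ext_covers z w -> b w <= top z) /\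
  (z != PInf P -> exists2 w, ext_covers z w & b w = top z).
Proof.
suff /fin_all_exists : forall z, exists v : int,
  (forall w, ext_covers z w -> b w <= v) /\
  (z != PInf P -> exists2 w, ext_covers z w & b w = v) by [].
move=> z; have [->|zN] := eqVneq z (PInf P).
  by exists 0; split=> // w /ext_covers_lt /ext_lt_neqPInf /eqP.
have [w0 zw0 _] := exists_cover (ext_lt_PInf zN).
have [w zw wmax] := exists_max_int b zw0.
by exists (b w); split=> // _; exists w.
Qed.

Section Transfer.
Context (b top : E -> int).
Context (b_le : forall z k, (k <= t)%N -> ext_lt (X k) z -> b z + D (X k) z <= al k).
Context (b_eq : forall z, z != MInf P ->
  exists k, [/\ (k <= t)%N, ext_lt (X k) z & b z + D (X k) z = al k]).
Context (top_ge : forall z w, ext_covers z w -> b w <= top z).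
Context (top_eq : forall z, z != PInf P -> exists2 w, ext_covers z w & b w = top z).

(* Along a tight cover the chain sums of [transfer] telescope without loss. *)
Definition tight z w := ext_covers z w && (b w == top z).

(** Stanley's transfer map from the order polytope to the chain polytope, in order-reversing form;
    [al 0] stands for the height of -oo. *)
Definition transfer : expo P :=
  [ffun o => if o is Some x then b (Elt x) - top (Elt x) else al 0%N].

(** An index attaining the minimum at [z] also competes at [w], where the reverse triangle
    inequality lowers its value by at least [eps]. *)
Lemma b_covers z w : z != MInf P -> ext_covers z w -> b w + eps <= b z.
Proof.
move=> zN zw; have [k [kt kz e]] := b_eq zN; have zw' := ext_covers_lt zw.
have := b_le kt (ext_lt_trans kz zw').
have := qdist_super heps (ext_ltW kz) (ext_ltW zw'); have := qdist_covers heps zw; lia.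
Qed.

(** Replaces [b_covers] at the points [X k], with [al k] in place of [b (X k)]; this includes -oo,
    where [b] is arbitrary. *)
Lemma b_covers_X k w : (k <= t)%N -> ext_covers (X k) w -> b w + eps <= al k.
Proof.
move=> kt kw; have := b_le kt (ext_covers_lt kw).
have := qdist_covers heps kw; lia.
Qed.

(** By [al_ge] no index gives a smaller value at [Y k] than [k] itself. *)
Lemma b_Y k : (k <= t)%N -> b (Y k) = be k.
Proof.
move=> kt; apply/eqP; rewrite eq_le; apply/andP; split.
  by have := b_le kt (XY kt); rewrite alE //; lia.
have [l [lt lk e]] := b_eq (ext_lt_neqMInf (XY kt)).
have := al_ge lt kt lk; lia.
Qed.

Lemma b_PInf : b (PInf P) = 0.
Proof. by rewrite -Yt b_Y. Qed.

Lemma b_path z s : z != MInf P -> path (@ext_covers _ P) z s ->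
  b (last z s) + eps * (size s)%:Z <= b z.
Proof.
elim: s z => [|u s IHs] z zN /=; first by rewrite mulr0 addr0.
case/andP=> zu ps; have := b_covers zN zu.
have := IHs u (ext_lt_neqMInf (ext_covers_lt zu)) ps.
by rewrite -[(size s).+1]addn1 PoszD mulrDr mulr1; lia.
Qed.

(** [b_path] bounds [b] from below along the chain and the hypothesis bounds the first step from
    above by the same number. Hence no cover loses more than [eps], and every step is a best one. *)
Lemma tight_geodesic z s : s != [::] -> path (@ext_covers _ P) z s ->
  (forall u, ext_covers z u -> b u <= b (last z s) + eps * (size s).-1%:Z) ->
  [/\ path tight z s, {in s, forall u, u = last z s \/ b u = top u + eps}
    & top z = b (last z s) + eps * (size s).-1%:Z].
Proof.
elim: s z => // u s IHs z _ /= /andP[zu ps] ub.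
have uN := ext_lt_neqMInf (ext_covers_lt zu).
have bu : b u = b (last u s) + eps * (size s)%:Z.
  by apply/eqP; rewrite eq_le ub //= b_path.
have topz : top z = b u.
  have [w zw bw] := top_eq (ext_lt_neqPInf (ext_covers_lt zu)).
  by apply/eqP; rewrite eq_le top_ge // -bw bu ub.
have tzu : tight z u by rewrite /tight zu topz eqxx.
rewrite -bu tzu; case: s IHs ps ub bu => [|v s] IHs ps ub bu.
  by split=> //= v; rewrite inE => /eqP ->; left.
have [|tps mid topu] := IHs u isT ps.
  by move=> w uw; have := b_covers uN uw; rewrite bu /= -[(size s).+1]addn1 PoszD mulrDr mulr1; lia.
split=> // w; rewrite in_cons => /predU1P[->|/mid //]; right.
by rewrite bu topu /= -[(size s).+1]addn1 PoszD mulrDr mulr1 addrA.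
Qed.

Lemma tight_path k w : (k <= t)%N -> ext_lt (X k) w -> b w + D (X k) w = al k ->
  exists s, [/\ path tight (X k) s, last (X k) s = w,
    {in s, forall u, u = w \/ b u = top u + eps} & top (X k) = al k - eps].
Proof.
move=> kt kw e; have [s [ps ls Ds]] := qdist_path heps (ext_ltW kw).
have sN : s != [::] by apply: contraTneq kw => s0; rewrite -ls s0 ext_ltxx.
(* An optimal chain makes the bound of [b_covers_X] coincide with the upper bound that
   [tight_geodesic] asks for. *)
have alk : al k - eps = b (last (X k) s) + eps * (size s).-1%:Z.
  rewrite ls -e Ds; case: s sN {ps ls Ds} => // u s _ /=.
  by rewrite -[(size s).+1]addn1 PoszD mulrDr mulr1; ring.
have [u ku|tps mid topX] := tight_geodesic sN ps.
  by rewrite -alk lerBrDr b_covers_X.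
by exists s; split=> //; [rewrite -ls | rewrite topX alk].
Qed.

Lemma tight_to_X k : (k <= t)%N ->
  exists2 s, path tight (MInf P) s & last (MInf P) s = X k.
Proof.
(* The induction runs on the element [X k] and not on [k]: the envelope at [X k] is attained by some
   [X l] below it, with no control on the index [l]. *)
move=> kt; move: {-2}(X k) (erefl (X k)) => z.
elim/(@ext_lt_ind_down _ P): z k kt => z IHz k kt ek.
have [->|zN] := eqVneq z (MInf P); first by exists [::].
have [l [lt lz e]] := b_eq zN.
have [s1 p1 l1] := IHz _ lz l lt erefl.
have [s2 [p2 l2 _ _]] := tight_path lt lz e.
by exists (s1 ++ s2); rewrite ?last_cat ?cat_path l1 ?p1.
Qed.

Lemma tight_to_PInf z : exists2 s, path tight z s & last z s = PInf P.
Proof.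
elim/(@ext_lt_ind_up _ P): z => z IHz; have [->|zN] := eqVneq z (PInf P); first by exists [::].
have [w zw bw] := top_eq zN; have [s ps ls] := IHz w (ext_covers_lt zw).
by exists (w :: s) => //=; rewrite /tight zw bw eqxx.
Qed.

Lemma tight_covers z s : path tight z s -> path (@ext_covers _ P) z s.
Proof. by apply: sub_path => u v /andP[]. Qed.

(** The weights [b u - top u] telescope, since [b u <= top z] for each cover [u] of [z], and [b]
    vanishes at oo. *)
Lemma sum_transfer_le z s : z != PInf P -> path (@ext_covers _ P) z s ->
  last z s = PInf P -> \sum_(u <- s) weight transfer u <= top z.
Proof.
elim: s z => [|u s IHs] z zN /=; first by move=> _ /eqP; rewrite (negbTE zN).
case/andP=> zu ps ls; rewrite big_cons; have := top_ge zu.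
have uN := ext_lt_neqMInf (ext_covers_lt zu).
case: (eqVneq u (PInf P)) => [up|uN']; last first.
  have := IHs u uN' ps ls; case: u uN uN' {zu ps ls} => [[x|]|] //= _ _.
  rewrite ffunE => h1 h2; apply: le_trans h2.
  by rewrite -lerBrDl opprB addrC subrK.
case: s ps ls {IHs} => [|v s] /=; first by rewrite big_nil up b_PInf.
by case/andP=> /ext_covers_lt/ext_lt_neqPInf; rewrite up eqxx.
Qed.

Lemma sum_transfer_tight z s : z != PInf P -> path tight z s ->
  last z s = PInf P -> \sum_(u <- s) weight transfer u = top z.
Proof.
elim: s z => [|u s IHs] z zN /=; first by move=> _ /eqP; rewrite (negbTE zN).
case/andP=> /andP[zu /eqP tz] ps ls; rewrite big_cons -tz.
have uN := ext_lt_neqMInf (ext_covers_lt zu).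
case: (eqVneq u (PInf P)) => [up|uN']; last first.
  rewrite (IHs u uN' ps ls); case: u uN uN' {zu ps ls tz} => [[x|]|] //= _ _.
  by rewrite ffunE subrK.
case: s ps ls {IHs} => [|v s] /=; first by rewrite big_nil up b_PInf.
by case/andP=> /andP[/ext_covers_lt/ext_lt_neqPInf]; rewrite up eqxx.
Qed.

Lemma tight_X_Y k : (k <= t)%N ->
  exists s, [/\ path tight (X k) s, last (X k) s = Y k,
    {in s, forall u, u = Y k \/ b u = top u + eps} & top (X k) = al k - eps].
Proof. by move=> kt; apply: tight_path; rewrite ?XY ?b_Y ?alE. Qed.

Lemma top_MInf : top (MInf P) = al 0%N - eps.
Proof. by have [s [_ _ _ h]] := tight_X_Y (leq0n t); rewrite -X0. Qed.

Lemma transfer_facets : facets eps transfer.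
Proof.
split=> [x|s /andP[ps /eqP ls]].
  have [|w xw bw] := top_eq (z := Elt x); first by [].
  by rewrite ffunE -bw; have := b_covers (z := Elt x) isT xw; lia.
rewrite (sum_elts _ ps) [transfer None]ffunE -lerBrDr -top_MInf.
exact: sum_transfer_le ps ls.
Qed.

(** Tightness concerns consecutive pairs only, so tight paths from -oo to [X k], on to [Y k] and on
    to oo can be glued. *)
Lemma tight_chain k : (k <= t)%N -> exists s, [/\ maximal_path s,
  \sum_(x in elts s) transfer (Some x) + eps = transfer None
  & forall x, x \in elts s -> [|| ext_le (Elt x) (X k), ext_le (Y k) (Elt x)
       | transfer (Some x) == eps]].
Proof.
move=> kt; have [s1 p1 l1] := tight_to_X kt.
have [s2 [p2 l2 mid _]] := tight_X_Y kt; have [s3 p3 l3] := tight_to_PInf (Y k).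
have pt : path tight (MInf P) (s1 ++ s2 ++ s3) by rewrite !cat_path p1 l1 p2 l2.
have ls : last (MInf P) (s1 ++ s2 ++ s3) = PInf P by rewrite !last_cat l1 l2.
exists (s1 ++ s2 ++ s3); split.
- by rewrite /maximal_path tight_covers // ls eqxx.
- rewrite (sum_elts _ (tight_covers pt)) (sum_transfer_tight _ pt ls) // top_MInf.
  by rewrite [RHS]ffunE subrK.
move=> x; rewrite inE !mem_cat => /or3P[xs|xs|xs].
- by rewrite -l1 (path_covers_le_last (tight_covers p1)) // in_cons xs orbT.
- case: (mid _ xs) => [<-|e]; first by rewrite ext_lexx orbT.
  by rewrite ffunE e addrAC subrr add0r eqxx !orbT.
- by rewrite (path_covers_le (tight_covers p3)) ?orbT // in_cons xs orbT.
Qed.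

Lemma transfer_irreducible g : facets eps g -> RE (transfer - g) -> g = transfer.
Proof.
move=> [gx gs] Rr; apply/esym/eqP; rewrite -subr_eq0; apply/eqP.
have chains (k : 'I_t.+1) := tight_chain (ltn_ord k : (k <= t)%N).
have [s sP] := fin_all_exists chains.
have {}sP k : (k <= t)%N -> [/\ maximal_path (s (inord k)),
  \sum_(x in elts (s (inord k))) transfer (Some x) + eps = transfer None
  & forall x, x \in elts (s (inord k)) ->
      [|| ext_le (Elt x) (X k), ext_le (Y k) (Elt x) | transfer (Some x) == eps]].
  by move=> kt; have := sP (inord k); rewrite inordK.
apply: (@zigzag_RE t X Y (fun k => elts (s (inord k)))) => //.
- by move=> k /sP[/andP[ps _] _ _]; exact: is_chain_elts ps.
- move=> k c /sP[_ _ h] /h /or3P[->|->|/eqP e]; rewrite ?orbT //.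
  (* Where [transfer] has the least value [eps], [g] cannot be smaller, and nonnegativity of the
     difference forces equality. *)
  have := Rr.2.1 c; rewrite expoB e => r0.
  by rewrite eq_le r0 subr_le0 gx !orbT.
(* The facet of this chain is an equality for [transfer] and an inequality for [g]; subtract. *)
- move=> k /sP[ms e _]; under eq_bigr do rewrite expoB.
  rewrite sumrB expoB -e lerBlDr.
  rewrite -addrA lerD2l addrC lerBrDl; exact: gs _ ms.
Qed.

End Transfer.

Lemma exists_irreducible : exists m, [/\ deg m = al 0%N, facets eps m
  & forall g, facets eps g -> RE (m - g) -> g = m].
Proof.
have [b bP] := exists_envelope; have [top topP] := exists_cover_max b.
exists (transfer b top); split; first by rewrite /deg ffunE.
  by apply: transfer_facets => z; case: (bP z); case: (topP z).
by move=> g; apply: transfer_irreducible => z; case: (bP z); case: (topP z).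
Qed.

End Envelope.
End Zigzag.

(** * From a reduced sequence to heights and a generator *)

Lemma qseq_window (disp : Order.disp_t) (P : finPOrderType disp) (eps : int)
    (W Z : seq (ext P)) (i j : nat) :
  (i <= j)%N -> (j < size W)%N -> (j < size Z)%N ->
  qseq eps (drop i (take j.+1 W)) (drop i (take j.+1 Z)) =
  \sum_(i <= l < j) (qdist eps (nth (MInf P) W l) (nth (MInf P) Z l)
                     - qdist eps (nth (MInf P) W l.+1) (nth (MInf P) Z l))
  + qdist eps (nth (MInf P) W j) (nth (MInf P) Z j).
Proof.
move=> ij jW jZ; rewrite /qseq size_drop size_takel // subSn //= big_ord_recr /=.
have wn (V : seq (ext P)) l : (l <= j - i)%N ->
    nth (MInf P) (drop i (take j.+1 V)) l = nth (MInf P) V (i + l).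
  by move=> lt; rewrite nth_drop nth_take //; lia.
have shift (F : nat -> int) : \sum_(i <= l < j) F l = \sum_(l < j - i) F (i + l)%N.
  by rewrite -{1}[i]add0n big_addn big_mkord; apply: eq_bigr => l _; rewrite addnC.
rewrite !wn // subnKC // sumrB addrAC !shift; congr (_ - _ + _).
  by apply: eq_bigr => l _; rewrite !wn ?(ltnW (ltn_ord l)).
by apply: eq_bigr => l _; rewrite !wn ?(ltnW (ltn_ord l)) // addnS.
Qed.

Lemma facets_generator (disp : Order.disp_t) (P : finPOrderType disp) (eps : int)
    (m : expo P) :
  eps = 1 \/ eps = -1 -> facets eps m ->
  (forall g, facets eps g -> RE (m - g) -> g = m) ->
  is_generator (if eps == 1 then @omegaE _ P else @antiE _ P) m.
Proof.
move=> heps fm irr.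
have SE f : (if eps == 1 then @omegaE _ P else @antiE _ P) f <-> facets eps f.
  by case: heps => -> /=; [exact: omegaE_facets | exact: antiE_facets].
apply: (@irreducible_is_generator _ _ _ (- #|P|.+1%:Z)) => [g /SE|//|g /SE]; last exact: irr.
- exact: facets_None_ge.
- by apply/SE.
Qed.

Theorem mainTheorem16 (K : fieldType) (disp : Order.disp_t) (P : finPOrderType disp)
  (eps : int) (heps : eps = 1 \/ eps = -1)
  (xs ys : seq P) (hN : condN' xs ys) (hred : qreduced eps xs ys)
  (d : int)
  (hd0 : qdist eps (MInf P) (PInf P) <= d) (hdmax : d <= qval eps xs ys) :
  exists m : expo P,
    is_generator (if eps == 1 then @omegaE _ P else @antiE _ P) m /\ deg m = d.
Proof.
have [szx [xy [xyS nxy]]] := hN.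
pose X k := nth (MInf P) (Xfull xs) k; pose Y k := nth (MInf P) (Yfull ys) k.
pose D := @qdist _ P eps; pose n := size ys.
have szX : size (Xfull xs) = n.+1 by rewrite /= size_map szx.
have szY : size (Yfull ys) = n.+1 by rewrite size_rcons size_map.
have Ylt k : (k < n)%N -> Y k = nth (MInf P) (map (@Elt _ P) ys) k.
  by move=> kn; rewrite /Y nth_rcons size_map kn.
have YX k : (k < n)%N -> ext_lt (X k.+1) (Y k) by move=> kn; rewrite Ylt //; exact: xy.
have XY k : (k < n)%N -> ext_lt (X k) (Y k).
  case: k => [|k] kn; last by rewrite Ylt //; exact: xyS.
  exact/ext_lt_MInf/(ext_lt_neqMInf (YX 0%N kn)).
have Xinf k : (k <= n)%N -> ext_lt (X k) (PInf P).
  move=> kn; apply: ext_lt_PInf; case: k kn => [|k] kn //.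
  exact: ext_lt_neqPInf (YX k kn).
pose al k := d - \sum_(0 <= l < k) (D (X l) (Y l) - D (X l.+1) (Y l)).
(* Values of consecutive subsequences become differences of heights, which turns reducedness into an
   inequality between heights. *)
have alD i j : (i <= j)%N -> (j <= n)%N ->
    qseq eps (drop i (take j.+1 (Xfull xs))) (drop i (take j.+1 (Yfull ys)))
    = al i - al j + D (X j) (Y j).
  move=> ij jn; rewrite qseq_window ?szX ?szY // /al (@big_cat_nat _ _ _ i 0 j) //=.
  rewrite -/(D _ _); congr (_ + _).
  by rewrite -[LHS]/(\sum_(i <= l < j) (D (X l) (Y l) - D (X l.+1) (Y l))); ring.
have alS k : al k.+1 = al k - D (X k) (Y k) + D (X k.+1) (Y k).
  by rewrite /al big_nat_recr //= opprD opprB addrA addrA addrAC.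
(* This is where [d <= qval eps xs ys] enters: the last index qualifies as a cut, so a first one
   exists. *)
have al_last : al n <= D (X n) (PInf P).
  have := alD 0%N n (leq0n n) (leqnn n).
  have -> : Y n = PInf P by rewrite /Y nth_rcons size_map ltnn eqxx.
  rewrite !drop0 !take_oversize ?szX ?szY // -/(qval eps xs ys) {1}/al big_geq // subr0.
  by move=> e; move: hdmax; rewrite e; lia.
pose crossed k := (k <= n)%N && (al k <= D (X k) (PInf P)).
have ex_crossed : exists k, crossed k by exists n; rewrite /crossed leqnn.
case: (ex_minnP ex_crossed) => t /andP[tn alt] tmin.
have al_gt k : (k < t)%N -> D (X k) (PInf P) <= al k.
  move=> kt; apply/ltW; rewrite ltNge; apply/negP => le.
  by have := tmin k; rewrite /crossed le andbT => /(_ (ltnW (leq_trans kt tn))); lia.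
pose Y' k := if k == t then PInf P else Y k.
pose al' k := if k == t then D (X t) (PInf P) else al k.
pose be' k := if k == t then 0 else al k - D (X k) (Y k).
have [|||||||m [dm fm irr]] := @exists_irreducible _ P eps heps t X Y' al' be'.
- by [].
- by rewrite /Y' eqxx.
- by rewrite /be' eqxx.
- move=> k kt; rewrite /Y'; case: eqVneq => [->|kNt]; first exact: Xinf.
  by apply: XY; lia.
- move=> k kt; rewrite /al' /be' /Y'; case: eqVneq => [->|kNt]; first by rewrite add0r.
  by rewrite subrK.
- move=> k kt; rewrite /Y' ltn_eqF //; apply: YX; lia.
(* For [l = t] the bound is the choice of [t] as the first cut. For [l < t] it comes from
   reducedness if [k < l], from the definition of the heights if [k] is [l] or [l.+1], and N'
   excludes larger [k]. *)
- move=> k l kt lt; rewrite /Y' /be'; case: (eqVneq l t) => [_|lNt] kl.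
    rewrite add0r /al'; case: eqVneq => [->//|kNt]; apply: al_gt; lia.
  have {lt lNt} lt : (l < t)%N by lia.
  have al'_ge : al k <= al' k by rewrite /al'; case: eqVneq => [->|].
  apply: le_trans al'_ge.
  have [klt|lk|->] := ltngtP k l; last by rewrite subrK.
    have := hred k l klt; rewrite -/n => /(_ (ltnW (leq_trans lt tn)) kl).
    by rewrite alD ?(ltnW klt) //; [rewrite -/(X k) -/(Y l) -/(D _ _); lia|lia].
  case: k lk kt kl => // k; rewrite ltnS leq_eqVlt => /predU1P[<-|lk] kt kl.
    by rewrite alS.
  have kn : (k < n)%N by lia.
  by have := nxy l k lk kn; rewrite -Ylt ?(ltn_trans lk kn) // kl.
exists m; split; first exact: facets_generator.
(* If the cut is at 0, the degree is the distance from -oo to oo; then [d] is at most this number by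
   the cut and at least it by [hd0]. *)
rewrite dm /al'; case: eqVneq => [t0|_]; last by rewrite /al big_geq // subr0.
apply/eqP; rewrite eq_le -t0 hd0.
by move: alt; rewrite -t0 /al big_geq // subr0 => ->.
Qed.
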